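(* Let $c_\beta\in(0,1]$ and $c_\eta>0$. There is a constant $C$ depending only on $L,\sigma,\Delta_f,c_\beta,c_\eta$ such that the following holds. Suppose Assumptions (D1), (D3), (D4) hold, $T\ge n$, and Dis-Lion (v1) is run with $\beta_2=c_\beta n^{1/2}T^{-1/2}$, $\beta_2^2\le\beta_1\le\sqrt{\beta_2}$, $\eta=c_\eta n^{1/4}d^{-1/2}T^{-3/4}$, $0\le\lambda\le\frac1{2\eta T}$ and $\|\mathbf{x}_1\|_\infty\le\eta$. Then $$\frac1T\sum_{t=1}^T\mathbb{E}\left[\|\nabla f(\mathbf{x}_t)\|_1\right]\le C\,\frac{d^{1/2}}{n^{1/4}T^{1/4}}.$$
   Context: Distributed setting: $n$ nodes; $f(\mathbf{x})=\frac1n\sum_{j=1}^nf_j(\mathbf{x})$ with $f_j(\mathbf{x})=\mathbb{E}_{\xi^j\sim\mathcal{D}_j}[f_j(\mathbf{x};\xi^j)]$, where the distributions $\mathcal{D}_j$ may differ. Node $j$ draws samples $\xi^j\sim\mathcal{D}_j$, independent across nodes and time and of everything before, and can evaluate $\nabla f_j(\mathbf{x};\xi^j)$. $\|\cdot\|$ is the Euclidean norm, $\|\cdot\|_1,\|\cdot\|_\infty$ the $\ell_1$- and max-norms; $\operatorname{sign}$ acts coordinatewise with values in $\{-1,0,1\}$. (D1) each $f_j$ is $L$-smooth: $\|\nabla f_j(\mathbf{x})-\nabla f_j(\mathbf{y})\|\le L\|\mathbf{x}-\mathbf{y}\|$. (D3) $\mathbb{E}_{\xi}[\nabla f_j(\mathbf{x};\xi)]=\nabla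 f_j(\mathbf{x})$ and $\mathbb{E}_\xi\|\nabla f_j(\mathbf{x};\xi)-\nabla f_j(\mathbf{x})\|^2\le\sigma^2$ for all $j,\mathbf{x}$. (D4) $f_*=\inf_{\mathbf{x}}f(\mathbf{x})>-\infty$ and $f(\mathbf{x}_1)-f_*\le\Delta_f$. Dis-Lion (v1): given $\mathbf{x}_1$, $\beta_1,\beta_2\in(0,1]$, $\eta>0$, $\lambda\ge0$. At $t=1$ each node sets $\mathbf{v}_1^j=\mathbf{m}_1^j=\nabla f_j(\mathbf{x}_1;\xi_1^j)$. For $t\ge2$ each node draws a fresh $\xi_t^j$ and sets $\mathbf{v}_t^j=(1-\beta_1)\mathbf{m}_{t-1}^j+\beta_1\nabla f_j(\mathbf{x}_t;\xi_t^j)$, $\mathbf{m}_t^j=(1-\beta_2)\mathbf{m}_{t-1}^j+\beta_2\nabla f_j(\mathbf{x}_t;\xi_t^j)$. The server forms $\mathbf{v}_t=\sum_{j=1}^n\mathbf{v}_t^j$, and all nodes update $\mathbf{x}_{t+1}=\mathbf{x}_t-\eta(\operatorname{sign}(\mathbf{v}_t)+\lambda\mathbf{x}_t)$. *)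

(* Defs.v *)
From mathcomp Require Import all_boot all_order all_algebra.
From mathcomp Require Import all_classical all_reals all_analysis.
Set Implicit Arguments. Unset Strict Implicit. Unset Printing Implicit Defensive.
Import Order.TTheory GRing.Theory Num.Theory numFieldNormedType.Exports.
Local Open Scope ring_scope.
Local Open Scope classical_set_scope.

Definition enorm (R : realType) (d : nat) (v : 'rV[R]_d) : R :=
  Num.sqrt (\sum_(i < d) (v 0 i) ^+ 2).
Definition norm1 (R : realType) (d : nat) (v : 'rV[R]_d) : R :=
  \sum_(i < d) `|v 0 i|.
Definition normInf (R : realType) (d : nat) (v : 'rV[R]_d) : R :=
  \big[Num.max/0]_(i < d) `|v 0 i|.
Definition dotv (R : realType) (d : nat) (u v : 'rV[R]_d) : R :=
  \sum_(i < d) u 0 i * v 0 i.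
Definition signv (R : realType) (d : nat) (v : 'rV[R]_d) : 'rV[R]_d :=
  map_mx (fun a => Num.sg a) v.

(* Conversion from d-tuples (which carry the product Borel sigma-algebra
   in mathcomp-analysis) to row vectors; used only to state joint
   measurability of the stochastic gradient oracle. *)
Definition rv_of_tuple (R : realType) (d : nat) (t : d.-tuple R) : 'rV[R]_d :=
  \row_(i < d) tnth t i.

Definition has_gradient (R : realType) (d : nat)
    (f : 'rV[R]_d -> R) (gf : 'rV[R]_d -> 'rV[R]_d) : Prop :=
  forall x : 'rV[R]_d, differentiable f x /\
    forall v : 'rV[R]_d, 'd f x v = dotv (gf x) v.

(* Dis-Lion (v1), run along one outcome.  G j x s is the stochastic gradient
   nabla f_j(x; s) computed at node j; samp t j is the sample xi_t^j drawn
   by node j at time t (t >= 1).  lion_state k returns the pair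
   (x_{k+1}, (m_k^j)_j) for k >= 1, and (x_1, junk) for k = 0. *)
Fixpoint lion_state (R : realType) (d n : nat) (Xi : Type)
    (G : 'I_n -> 'rV[R]_d -> Xi -> 'rV[R]_d) (samp : nat -> 'I_n -> Xi)
    (x1 : 'rV[R]_d) (beta1 beta2 eta lambda : R) (k : nat)
    : 'rV[R]_d * ('I_n -> 'rV[R]_d) :=
  match k with
  | 0 => (x1, fun _ => 0)
  | 1 =>
      let g := fun j => G j x1 (samp 1%N j) in
      let v := \sum_(j < n) g j in
      (x1 - eta *: (signv v + lambda *: x1), g)
  | k'.+1 =>
      let (x, m) := lion_state G samp x1 beta1 beta2 eta lambda k' in
      let g := fun j => G j x (samp k j) in
      let v := \sum_(j < n) ((1 - beta1) *: m j + beta1 *: g j) in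
      (x - eta *: (signv v + lambda *: x),
       fun j => (1 - beta2) *: m j + beta2 *: g j)
  end.

Definition lion_x (R : realType) (d n : nat) (Xi : Type)
    (G : 'I_n -> 'rV[R]_d -> Xi -> 'rV[R]_d) (samp : nat -> 'I_n -> Xi)
    (x1 : 'rV[R]_d) (beta1 beta2 eta lambda : R) (t : nat) : 'rV[R]_d :=
  (lion_state G samp x1 beta1 beta2 eta lambda t.-1).1.

Definition indep_samples (R : realType) (dO dX : measure_display)
    (Omega : measurableType dO) (Xi : measurableType dX) (n T : nat)
    (P : probability Omega R) (D : 'I_n -> probability Xi R)
    (xi : nat -> 'I_n -> Omega -> Xi) : Prop :=
  (forall t j, (1 <= t <= T)%N -> measurable_fun setT (xi t j)) /\
  forall (s : seq (nat * 'I_n)) (A : nat * 'I_n -> set Xi),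
    uniq s -> all (fun k => (1 <= k.1 <= T)%N) s ->
    (forall k, measurable (A k)) ->
    P (\bigcap_(k in [set` s]) (xi k.1 k.2 @^-1` A k)) =
    (\prod_(k <- s) D k.2 (A k))%E.

(* Main.v *)
Require Import Defs.
From HB Require Import structures.
From mathcomp Require Import all_boot all_order all_algebra.
From mathcomp Require Import all_classical all_reals all_analysis.
From mathcomp Require Import measurable_realfun ring lra.
Import Order.TTheory GRing.Theory Num.Theory numFieldNormedType.Exports.
Local Open Scope ring_scope.
Local Open Scope classical_set_scope.
Set Implicit Arguments. Unset Strict Implicit. Unset Printing Implicit Defensive.

(** The argument compares the update direction u_t = v_t / n with the gradient
    g_t of the averaged objective.  Since the decay keeps lambda * |x_t|_oo
    below 1/2, smoothness gives, along every outcome,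
      F(x_(t+1)) <= F(x_t) - eta/2 |g_t|_1 + 2 eta |g_t - u_t|_1 + O(eta^2 d),
    and Young's inequality with weight rho = (n T)^(-1/4) replaces |.|_1 by
    sqrt d (|.|^2 / (2 rho) + rho / 2), so only second moments matter.  The mean
    momentum m_t = (1/n) sum_j m_t^j obeys
      m_(t+1) - g_(t+1) = (1 - beta2) (m_t - g_t + g_t - g_(t+1)) + beta2 * noise,
    where the noise has conditional mean 0 and conditional second moment at most
    sigma^2 / n, hence E|m_(t+1) - g_(t+1)|^2 is at most
      (1 - beta2) E|m_t - g_t|^2 + L^2 O(eta^2 d) / beta2 + beta2^2 sigma^2 / n.
    Conditioning is replaced by freezing: the sigma-algebra of the past
    samples is independent of a fresh sample, so by Tonelli the fresh sample can
    be integrated out first, one node after the other. *)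

(** * Integrating out a fresh sample *)

(** The factorisation on rectangles forces the law of [(Y, Z)] to be the product of the law of [Y]
    with [D]; Tonelli and a change of variables do the rest. *)
Lemma ge0_integral_indep (R : realType) (dO d1 d2 : measure_display)
    (Omega : measurableType dO) (T1 : measurableType d1)
    (T2 : measurableType d2) (P : probability Omega R)
    (D : probability T2 R) (Y : Omega -> T1) (Z : Omega -> T2)
    (h : T1 * T2 -> \bar R) :
  measurable_fun setT Y -> measurable_fun setT Z ->
  (forall A B, measurable A -> measurable B ->
     P (Y @^-1` A `&` Z @^-1` B) = (P (Y @^-1` A) * D B)%E) ->
  measurable_fun [set: (T1 * T2)%type] h -> (forall z, (0 <= h z)%E) ->
  (\int[P]_w h (Y w, Z w) = \int[P]_w \int[D]_z h (Y w, z))%E.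
Proof.
move=> mY mZ PYZ mh h0.
have mYZ : measurable_fun setT (fun w => (Y w, Z w)).
  exact: measurable_fun_pair.
pose y : {mfun Omega >-> T1} := HB.pack Y (isMeasurableFun.Build _ _ _ _ _ mY).
pose yz : {mfun Omega >-> (T1 * T2)%type} :=
  HB.pack (fun w => (Y w, Z w)) (isMeasurableFun.Build _ _ _ _ _ mYZ).
transitivity (\int[distribution P yz]_p h p)%E.
  by rewrite ge0_integral_pushforward.
transitivity (\int[(distribution P y \x D)%E]_p h p)%E.
  apply: eq_measure_integral => A mA _; apply/esym.
  apply: product_measure_unique => // B C mB mC.
rewrite fubini_tonelli1// ge0_integral_pushforward//.
  exact: measurable_fun_fubini_tonelli_F.
by move=> x _; exact: integral_ge0.
Qed.

(* For a finite list K these already form a pi-system generating the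
   sigma-algebra of the family (X k), k in K: taking A k = setT drops an index. *)
Definition cylinders (I : eqType) (Omega : Type) (d : measure_display)
    (S : measurableType d) (X : I -> Omega -> S) (K : seq I) :
    set (set Omega) :=
  [set E | exists2 A : I -> set S, (forall k, measurable (A k)) &
    E = \bigcap_(k in [set` K]) (X k @^-1` A k)].

Lemma setI_closed_cylinders (I : eqType) (Omega : Type)
    (d : measure_display) (S : measurableType d) (X : I -> Omega -> S)
    (K : seq I) : setI_closed (cylinders X K).
Proof.
move=> _ _ [A mA ->] [B mB ->]; exists (fun k => A k `&` B k).
  by move=> k; exact: measurableI.
by rewrite -bigcapI.
Qed.

Lemma bigcap_preimage_cons (I : eqType) (Omega S : Type)
    (X : I -> Omega -> S) (K : seq I) (k0 : I) (A : I -> set S) :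
  \bigcap_(k in [set` k0 :: K]) (X k @^-1` A k) =
  X k0 @^-1` A k0 `&` \bigcap_(k in [set` K]) (X k @^-1` A k).
Proof.
apply/seteqP; split=> [w H|w [H0 H] k /=]; last first.
  by rewrite inE => /orP[/eqP->//|]; exact: H.
split=> [|k kK]; first by apply: H; rewrite /= mem_head.
by apply: H; rewrite /= inE kK orbT.
Qed.

Lemma measurable_cylinders (I : eqType) (dO d : measure_display)
    (Omega : measurableType dO) (S : measurableType d) (X : I -> Omega -> S)
    (K : seq I) :
  (forall k, k \in K -> measurable_fun setT (X k)) ->
  cylinders X K `<=` measurable.
Proof.
move=> mX _ [A mA ->]; elim: K mX => [|k0 K IH] mX.
  rewrite (_ : [set` [::]] = set0) ?bigcap_set0//.
  by apply/seteqP; split=> // x; rewrite /= in_nil.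
rewrite bigcap_preimage_cons; apply: measurableI.
  by rewrite -[_ @^-1` _]setTI; apply: mX => //; exact: mem_head.
by apply: IH => k kK; apply: mX; rewrite inE kK orbT.
Qed.

Lemma measurable_fun_cylinders (I : eqType) (dO d : measure_display)
    (Omega : measurableType dO) (S : measurableType d) (X : I -> Omega -> S)
    (K : seq I) (k0 : I) : k0 \in K ->
  measurable_fun [set: g_sigma_algebraType (cylinders X K)] (X k0).
Proof.
move=> k0K _ B mB; rewrite setTI; apply: sub_sigma_algebra.
exists (fun k => if k == k0 then B else setT); first by move=> k; case: ifP.
apply/seteqP; split=> [w Bw k _ /=|w /(_ k0 k0K)]; last by rewrite /= eqxx.
by case: eqP => [->|].
Qed.

(** For fixed [B] both sides are finite measures in [E]. They agree on the cylinders, a pi-system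
    containing the whole space, hence on the sigma-algebra generated. *)
Lemma cylinders_indep (R : realType) (I : eqType) (dO d : measure_display)
    (Omega : measurableType dO) (S : measurableType d)
    (P : probability Omega R) (D : I -> probability S R)
    (X : I -> Omega -> S) (K : seq I) (k0 : I) :
  (forall k, k \in k0 :: K -> measurable_fun setT (X k)) ->
  (forall A : I -> set S, (forall k, measurable (A k)) ->
    P (\bigcap_(k in [set` k0 :: K]) (X k @^-1` A k)) =
    (\prod_(k <- k0 :: K) D k (A k))%E) ->
  k0 \notin K ->
  forall E B, <<s cylinders X K >> E -> measurable B ->
  P (E `&` X k0 @^-1` B) = (P E * D k0 B)%E.
Proof.
move=> mX PX k0K E B sE mB.
have mK : cylinders X K `<=` measurable.
  by apply: measurable_cylinders => k kK; apply: mX; rewrite inE kK orbT.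
have mXB : measurable (X k0 @^-1` B).
  by rewrite -[_ @^-1` _]setTI; apply: mX => //; exact: mem_head.
have r0 : 0 <= fine (D k0 B) by exact: fine_ge0.
pose r := NngNum r0.
have PX0 (A : I -> set S) (C : set S) :
    (forall k, measurable (A k)) -> measurable C ->
    P (\bigcap_(k in [set` K]) (X k @^-1` A k) `&` X k0 @^-1` C) =
    (\prod_(k <- K) D k (A k) * D k0 C)%E.
  (* Since [k0] is not in [K], redefining the family at [k0] leaves the constraints over [K]
     unchanged. *)
  move=> mA mC; pose A' k := if k == k0 then C else A k.
  have A'k0 : A' k0 = C by rewrite /A' eqxx.
  have AA' k : k \in K -> A' k = A k.
    by move=> kK; rewrite /A'; case: eqP => // kk0; rewrite -kk0 kK in k0K.
  have := PX A'; rewrite bigcap_preimage_cons big_cons {}A'k0 => PX'.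
  transitivity (P (X k0 @^-1` C `&` \bigcap_(k in [set` K]) X k @^-1` A' k)).
    rewrite setIC; congr (P (_ `&` _)).
    by apply: eq_bigcapr => k /= kK; rewrite AA'.
  rewrite PX'; last by move=> k; rewrite /A'; case: ifP.
  rewrite muleC; congr (_ * _)%E.
  by rewrite !big_seq; apply: eq_bigr => k /AA' ->.
suff H : mrestr P mXB E = mscale r P E.
  rewrite [LHS]H /mscale muleC; congr (_ * _)%E.
  by rewrite /= fineK// fin_num_measure.
have cT : cylinders X K setT.
  by exists (fun=> setT) => //; apply/esym/seteqP; split=> // w _ k _ //.
apply: (@g_sigma_algebra_measure_unique _ R _ (cylinders X K) mK
    (fun=> setT)) => //.
- by rewrite bigcup_const.
- exact: setI_closed_cylinders.
- move=> _ [A mA ->]; rewrite [LHS](PX0 A B mA mB).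
  (* Taking [C = setT] identifies the product over [K] with the probability of the cylinder. *)
  have := PX0 A setT mA measurableT.
  rewrite preimage_setT setIT probability_setT mule1 => <-.
  rewrite -[D k0 B]fineK ?fin_num_measure//; exact: muleC.
- by move=> _; rewrite /= /mrestr setTI; rewrite ltey_eq fin_num_measure.
Qed.

(* The type [g_sigma_algebraType (cylinders X K)] is Omega itself with a smaller
   sigma-algebra, so that measurability of h in its first argument means that h
   depends on the outcome only through the samples in K. *)
Lemma ge0_integral_fresh (R : realType) (I : eqType) (dO d : measure_display)
    (Omega : measurableType dO) (S : measurableType d)
    (P : probability Omega R) (D : I -> probability S R)
    (X : I -> Omega -> S) (K : seq I) (k0 : I)
    (h : g_sigma_algebraType (cylinders X K) * S -> \bar R) :
  (forall k, k \in k0 :: K -> measurable_fun setT (X k)) ->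
  (forall A : I -> set S, (forall k, measurable (A k)) ->
    P (\bigcap_(k in [set` k0 :: K]) (X k @^-1` A k)) =
    (\prod_(k <- k0 :: K) D k (A k))%E) ->
  k0 \notin K ->
  measurable_fun setT h -> (forall z, (0 <= h z)%E) ->
  (\int[P]_w h (w, X k0 w) = \int[P]_w \int[D k0]_z h (w, z))%E.
Proof.
move=> mX PX k0K mh h0.
(* The past is encoded by [Y = id], from Omega to Omega with the coarser sigma-algebra. *)
apply: (@ge0_integral_indep _ _ _ _ _
  (g_sigma_algebraType (cylinders X K)) _ P (D k0) id (X k0)) => //.
- move=> _ A mA; rewrite setTI preimage_id.
  apply: (smallest_sub (@sigma_algebra_measurable _ Omega)) mA.
  by apply: measurable_cylinders => k kK; apply: mX; rewrite inE kK orbT.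
- by apply: mX; exact: mem_head.
- by move=> A B mA mB; exact: (cylinders_indep mX PX).
Qed.

(** * Stochastic gradient oracles *)

Definition sqnorm (R : realType) (d : nat) (v : 'rV[R]_d) : R :=
  \sum_(i < d) v 0 i ^+ 2.

Lemma sqnorm_ge0 (R : realType) (d : nat) (v : 'rV[R]_d) : 0 <= sqnorm v.
Proof. by apply: sumr_ge0 => i _; exact: sqr_ge0. Qed.

Lemma enorm_sqr (R : realType) (d : nat) (v : 'rV[R]_d) :
  enorm v ^+ 2 = sqnorm v.
Proof. by rewrite sqr_sqrtr//; exact: sqnorm_ge0. Qed.

Section vector_measurability.
Context (R : realType) (d : nat) (dT : measure_display)
  (T : measurableType dT).

Definition measurable_rv (X : T -> 'rV[R]_d) : Prop :=
  forall i, measurable_fun setT (fun w => X w 0 i).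

Lemma measurable_rv_cst (v : 'rV[R]_d) : measurable_rv (fun=> v).
Proof. by move=> i; exact: measurable_cst. Qed.

Lemma measurable_rvD (X Y : T -> 'rV[R]_d) :
  measurable_rv X -> measurable_rv Y -> measurable_rv (fun w => X w + Y w).
Proof.
move=> mX mY i; under eq_fun do rewrite mxE.
exact: measurable_funD (mX i) (mY i).
Qed.

Lemma measurable_rvZ (c : R) (X : T -> 'rV[R]_d) :
  measurable_rv X -> measurable_rv (fun w => c *: X w).
Proof.
move=> mX i; under eq_fun do rewrite mxE.
by apply: measurable_funM => //; exact: measurable_cst.
Qed.

Lemma measurable_rvB (X Y : T -> 'rV[R]_d) :
  measurable_rv X -> measurable_rv Y -> measurable_rv (fun w => X w - Y w).
Proof.
move=> mX mY i; under eq_fun do rewrite !mxE.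
exact: measurable_funB (mX i) (mY i).
Qed.

Lemma measurable_rv_sum (I : eqType) (s : seq I) (X : I -> T -> 'rV[R]_d) :
  (forall j, j \in s -> measurable_rv (X j)) ->
  measurable_rv (fun w => \sum_(j <- s) X j w).
Proof.
elim: s => [|j s IH] mX.
  by under eq_fun do rewrite big_nil; exact: measurable_rv_cst.
under eq_fun do rewrite big_cons; apply: measurable_rvD.
  by apply: mX; exact: mem_head.
by apply: IH => k ks; apply: mX; rewrite inE ks orbT.
Qed.

Lemma measurable_sqnorm (X : T -> 'rV[R]_d) :
  measurable_rv X -> measurable_fun setT (fun w => sqnorm (X w)).
Proof.
by move=> mX; apply: measurable_sum => i; exact: measurable_funX (mX i).
Qed.

Lemma measurable_sqnormE (X : T -> 'rV[R]_d) :
  measurable_rv X -> measurable_fun setT (fun w => (sqnorm (X w))%:E).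
Proof. by move=> mX; apply/measurable_EFinP; exact: measurable_sqnorm. Qed.

End vector_measurability.

(** Assumption (D3) at one node. Measurability is joint in the point and the sample because the
    oracle is evaluated at random iterates. *)
Definition unbiased_oracle (R : realType) (d : nat) (dS : measure_display)
    (S : measurableType dS) (D : probability S R) (sigma : R)
    (gf : 'rV[R]_d -> 'rV[R]_d) (G : 'rV[R]_d -> S -> 'rV[R]_d) : Prop :=
  [/\ forall i : 'I_d, measurable_fun setT
        (fun p : d.-tuple R * S => G (rv_of_tuple p.1) p.2 0 i),
      forall x (i : 'I_d), D.-integrable setT (fun s => (G x s 0 i)%:E),
      forall x (i : 'I_d), (\int[D]_s (G x s 0 i)%:E)%E = (gf x 0 i)%:E &
      forall x, (\int[D]_s ((enorm (G x s - gf x)) ^+ 2)%:E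
                  <= (sigma ^+ 2)%:E)%E].

Section oracle.
Context (R : realType) (d : nat) (dS : measure_display)
  (S : measurableType dS) (D : probability S R) (sigma : R)
  (gf : 'rV[R]_d -> 'rV[R]_d) (G : 'rV[R]_d -> S -> 'rV[R]_d).
Hypothesis oG : unbiased_oracle D sigma gf G.

Lemma measurable_oracle (dT : measure_display) (T : measurableType dT)
    (X : T -> 'rV[R]_d) (Z : T -> S) :
  measurable_rv X -> measurable_fun setT Z ->
  measurable_rv (fun w => G (X w) (Z w)).
Proof.
move=> mX mZ i; case: oG => mG _ _ _.
pose u (w : T) : d.-tuple R * S := ([tuple X w 0 j | j < d], Z w).
have mu : measurable_fun setT u.
  apply: measurable_fun_pair => //; apply/measurable_fun_tnthP => j.
  by rewrite (_ : _ \o _ = fun w => X w 0 j)//; apply/funext => w;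
    rewrite /= tnth_mktuple.
rewrite (_ : (fun w => _) =
  (fun p : d.-tuple R * S => G (rv_of_tuple p.1) p.2 0 i) \o u).
  exact: measurableT_comp (mG i) mu.
apply/funext => w /=; rewrite /u /=; congr (fun_of_matrix (G _ _) 0 i).
apply/rowP => j.
by rewrite mxE tnth_mktuple.
Qed.

(* The mean is measurable as a parametric integral of the jointly measurable
   oracle; the identification of 'rV_d with d-tuples never requires the
   continuity of gf. *)
Lemma measurable_oracle_mean (dT : measure_display) (T : measurableType dT)
    (X : T -> 'rV[R]_d) :
  measurable_rv X -> measurable_rv (fun w => gf (X w)).
Proof.
move=> mX i; case: (oG) => _ _ eG _; apply/measurable_EFinP.
pose g (p : T * S) : \bar R := (G (X p.1) p.2 0 i)%:E.
have mg : measurable_fun setT g.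
  apply/measurable_EFinP.
  apply: (@measurable_oracle _ _ (fun p : T * S => X p.1) snd) => // j.
  exact: measurableT_comp (mX j) measurable_fst.
(* Tonelli gives measurability of parametric integrals of nonnegative functions, hence the split
   into positive and negative parts. *)
have -> : EFin \o (fun w => gf (X w) 0 i) =
    (fun w => \int[D]_s g^\+ (w, s) - \int[D]_s g^\- (w, s))%E.
  apply/funext => w; rewrite [LHS]/= -(eG (X w) i) [LHS]integralE.
  by congr (_ - _)%E; apply: eq_integral => s _; rewrite !(funeposE, funenegE).
apply: emeasurable_funB.
- by apply: measurable_fun_fubini_tonelli_F => //; exact: measurable_funepos.
- by apply: measurable_fun_fubini_tonelli_F => //; exact: measurable_funeneg.
Qed.

(** In the expanded square the cross term is linear in the centred noise, so it integrates to 0. *)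
Lemma oracle_second_moment (a x : 'rV[R]_d) (c : R) :
  (\int[D]_s (sqnorm (a + c *: (G x s - gf x)))%:E
    <= (sqnorm a + c ^+ 2 * sigma ^+ 2)%:E)%E.
Proof.
case: (oG) => mG iG eG vG.
pose e i s := G x s 0 i - gf x 0 i.
have ie i : D.-integrable setT (fun s => (e i s)%:E).
  rewrite (_ : (fun _ => _) = (fun s => (G x s 0 i)%:E - (gf x 0 i)%:E)%E)//.
  by apply: integrableB => //; exact: finite_measure_integrable_cst.
have me i : measurable_fun setT (e i).
  by apply/measurable_EFinP; case/integrableP: (ie i).
have e0 i : (\int[D]_s (e i s)%:E = 0)%E.
  rewrite (_ : (fun _ => _) = (fun s => (G x s 0 i)%:E - (gf x 0 i)%:E)%E)//.
  rewrite integralB ?eG//; last exact: finite_measure_integrable_cst.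
  by rewrite integral_cst// [X in (_ * X)%E]probability_setT mule1 subee.
pose q s := sqnorm (G x s - gf x).
have mGx : measurable_rv (fun s => G x s - gf x).
  move=> i; under eq_fun do rewrite !mxE; exact: me.
(* The variance bound makes the square integrable, so the integral may be split by linearity. *)
have iq : D.-integrable setT (fun s => (q s)%:E).
  apply/integrableP; split; first exact: measurable_sqnormE.
  under eq_integral => s _ do rewrite gee0_abs ?lee_fin ?sqnorm_ge0//.
  apply: le_lt_trans (ltry (sigma ^+ 2)); apply: le_trans (vG x).
  by under [leRHS]eq_integral => s _ do rewrite enorm_sqr.
have ilin : D.-integrable setT (fun s => \sum_(i < d) (2 * c * a 0 i)%:E * (e i s)%:E)%E.
  by apply: integrable_sum => // i _; exact: integrableZl.
have icst : D.-integrable setT (fun=> (sqnorm a)%:E).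
  exact: finite_measure_integrable_cst.
rewrite (eq_integral (fun s => ((sqnorm a)%:E +
    \sum_(i < d) (2 * c * a 0 i)%:E * (e i s)%:E) +
    (c ^+ 2)%:E * (q s)%:E)%E); last first.
  move=> s _; under eq_bigr do rewrite -EFinM.
  rewrite sumEFin -EFinM -!EFinD; congr _%:E.
  rewrite /q /sqnorm mulr_sumr -!big_split /=; apply: eq_bigr => i _.
  by rewrite !mxE /e; ring.
rewrite integralD//; [|exact: integrableD|exact: integrableZl].
rewrite integralD// integral_cst// [X in (_ * X)%E]probability_setT mule1.
rewrite integral_sum//; last by move=> i; exact: integrableZl.
rewrite big1 ?adde0; last by move=> i _; rewrite integralZl// e0 mule0.
rewrite integralZl// EFinD leeD2l// (EFinM (c ^+ 2)).
apply: lee_wpmul2l; first by rewrite lee_fin sqr_ge0.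
by apply: le_trans (vG x); under [leRHS]eq_integral => s _ do rewrite enorm_sqr.
Qed.

End oracle.

(** * Adapted vectors and second moments of fresh noise *)

Section sampling.
Context (R : realType) (d n T : nat) (dO dX : measure_display)
  (Omega : measurableType dO) (P : probability Omega R)
  (Xi : measurableType dX) (D : 'I_n -> probability Xi R)
  (gf : 'I_n -> 'rV[R]_d -> 'rV[R]_d)
  (G : 'I_n -> 'rV[R]_d -> Xi -> 'rV[R]_d)
  (xi : nat -> 'I_n -> Omega -> Xi) (sigma : R).
Hypothesis xiP : indep_samples T P D xi.
Hypothesis oG : forall j, unbiased_oracle (D j) sigma (gf j) (G j).

Let sample (k : nat * 'I_n) : Omega -> Xi := xi k.1 k.2.

Notation sigma_samples K := (g_sigma_algebraType (cylinders sample K)).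

(* A depends only on the samples of times 1, ..., k. *)
Definition adapted (k : nat) (A : Omega -> 'rV[R]_d) : Prop :=
  forall K : seq (nat * 'I_n), (forall s j, (1 <= s <= k)%N -> (s, j) \in K) ->
  @measurable_rv R d _ (sigma_samples K) A.

Let valid (K : seq (nat * 'I_n)) := all (fun k => (1 <= k.1 <= T)%N) K.

Let measurable_sample K k : valid K -> k \in K -> measurable_fun setT (sample k).
Proof. by move=> /allP vK /vK; case: xiP => mxi _; exact: (mxi k.1 k.2). Qed.

Let measurable_sigma_samples K (dS : measure_display) (S : measurableType dS)
    (f : Omega -> S) : valid K ->
  @measurable_fun _ _ (sigma_samples K) S setT f -> measurable_fun setT f.
Proof.
move=> vK mf.
have mid : @measurable_fun _ _ Omega (sigma_samples K) setT id.
  move=> _ A mA; rewrite setTI preimage_id.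
  apply: (smallest_sub (@sigma_algebra_measurable _ Omega)) mA.
  by apply: measurable_cylinders => k; exact: measurable_sample.
exact: (@measurableT_comp _ _ _ Omega (sigma_samples K) S f setT id mf mid).
Qed.

Let past (k : nat) : seq (nat * 'I_n) :=
  [seq (s, j) | s <- iota 1 k, j <- enum 'I_n].

Let mem_past k s j : ((s, j) \in past k) = (1 <= s <= k)%N.
Proof.
apply/allpairsP/idP => [[[s' j'] /= []]|sk].
  by rewrite mem_iota add1n ltnS => + _ [-> _].
by exists (s, j); rewrite /= mem_iota add1n ltnS mem_enum.
Qed.

Let uniq_past k : uniq (past k).
Proof.
apply: allpairs_uniq; [exact: iota_uniq|exact: enum_uniq|].
by move=> [? ?] [? ?] _ _.
Qed.

Lemma adapted_measurable (k : nat) (A : Omega -> 'rV[R]_d) :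
  (k <= T)%N -> adapted k A -> measurable_rv A.
Proof.
move=> kT mA i; apply: (@measurable_sigma_samples (past k)).
  apply/allP => -[s j]; rewrite mem_past /= => /andP[-> sk].
  exact: leq_trans sk kT.
by apply: mA => s j; rewrite mem_past.
Qed.

Let noise (X : Omega -> 'rV[R]_d) (t : nat) (j : 'I_n) (w : Omega) : 'rV[R]_d :=
  G j (X w) (xi t j w) - gf j (X w).

(** Freezing: [A] and [X] depend only on the samples in [K], so the sample [(t, j)] is integrated
    first, with both held fixed. *)
Let second_moment_sample (K : seq (nat * 'I_n)) (t : nat) (j : 'I_n)
    (A X : Omega -> 'rV[R]_d) (c : R) :
  uniq ((t, j) :: K) -> valid ((t, j) :: K) ->
  @measurable_rv R d _ (sigma_samples K) A ->
  @measurable_rv R d _ (sigma_samples K) X ->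
  (\int[P]_w (sqnorm (A w + c *: noise X t j w))%:E <=
   \int[P]_w (sqnorm (A w))%:E + (c ^+ 2 * sigma ^+ 2)%:E)%E.
Proof.
move=> uK vK mA mX.
have vK' : valid K by case/andP: vK.
pose T0 : measurableType _ := sigma_samples K.
pose h (p : T0 * Xi) : \bar R :=
  (sqnorm (A p.1 + c *: (G j (X p.1) p.2 - gf j (X p.1))))%:E.
have mh : measurable_fun setT h.
  have mX1 : @measurable_rv R d _ (T0 * Xi)%type (X \o fst).
    by move=> i; exact: measurableT_comp (mX i) measurable_fst.
  apply: measurable_sqnormE; apply: measurable_rvD.
    by move=> i; exact: measurableT_comp (mA i) measurable_fst.
  apply/measurable_rvZ/measurable_rvB.
    exact: (measurable_oracle (oG j) mX1 measurable_snd).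
  exact: (measurable_oracle_mean (oG j) mX1).
have h0 p : (0 <= h p)%E by rewrite lee_fin sqnorm_ge0.
rewrite [leLHS](@ge0_integral_fresh _ _ _ _ _ _ P (fun k => D k.2) sample K
  (t, j) h) //; first last.
- by case/andP: uK.
- by case: xiP => _ PK B mB; rewrite PK.
- by move=> k; exact: measurable_sample.
have mA' : measurable_fun setT (fun w => (sqnorm (A w))%:E).
  by apply: (measurable_sigma_samples vK'); exact: measurable_sqnormE.
rewrite -[X in (_ + X)%E](_ : \int[P]_w (cst (c ^+ 2 * sigma ^+ 2)%:E w) = _)%E; last first.
  by rewrite integral_cst// [X in (_ * X)%E]probability_setT mule1.
have c0 : 0 <= c ^+ 2 * sigma ^+ 2 by rewrite mulr_ge0 ?sqr_ge0.
rewrite -ge0_integralD//; last first.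
  by move=> w _; rewrite lee_fin sqnorm_ge0.
apply: ge0_le_integral => //.
- by move=> w _; exact: integral_ge0.
- apply: (measurable_sigma_samples vK').
  exact: (measurable_fun_fubini_tonelli_F (m2 := D j)).
- exact: emeasurable_funD.
- move=> w _; rewrite /cst -EFinD /h.
  exact: (oracle_second_moment (oG j) (A w) (X w) c).
Qed.

(** Nodes are removed one at a time, each at cost [c^2 sigma^2]. The total is linear in [n], which
    after averaging gives the variance [sigma^2 / n]. *)
Lemma second_moment_nodes (k : nat) (A X : Omega -> 'rV[R]_d) (c : R) :
  (k < T)%N -> adapted k A -> adapted k X ->
  (\int[P]_w (sqnorm (A w + c *: \sum_(j < n)
      (G j (X w) (xi k.+1 j w) - gf j (X w))))%:E <=
   \int[P]_w (sqnorm (A w))%:E + (n%:R * (c ^+ 2 * sigma ^+ 2))%:E)%E.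
Proof.
move=> kT mA mX; rewrite -[X in X%:R](size_enum_ord n).
under eq_integral do rewrite -big_enum.
elim: (enum 'I_n) (enum_uniq 'I_n) => [|j js IH] /=.
  rewrite mul0r adde0 => _; under eq_integral do rewrite big_nil scaler0 addr0.
  exact: lexx.
move=> /andP[jjs ujs].
pose K := [seq (k.+1, j') | j' <- js] ++ past k.
have mK A' : adapted k A' -> @measurable_rv R d _ (sigma_samples K) A'.
  by apply => s j' sk; rewrite mem_cat mem_past sk orbT.
pose A' w := A w + c *: \sum_(i <- js) noise X k.+1 i w.
under eq_integral do rewrite big_cons scalerDr addrCA addrC.
apply: (le_trans (@second_moment_sample K k.+1 j A' X c _ _ _ _)).
- rewrite cons_uniq mem_cat mem_past ltnn andbF orbF cat_uniq uniq_past andbT.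
  rewrite map_inj_uniq ?ujs; last by move=> ? ? [].
  apply/and3P; split=> //.
    by apply: contra jjs => /mapP[? ? [->]].
  by apply/hasPn => -[s j']; rewrite mem_past => sk; apply/mapP => -[? _ [sE _]];
    rewrite sE ltnn andbF in sk.
- rewrite /valid /= kT /= all_cat all_map; apply/andP; split.
    by apply/allP => j' _ /=; rewrite kT.
  apply/allP => -[s j']; rewrite mem_past /= => /andP[-> sk].
  exact: leq_trans sk (ltnW kT).
- apply: measurable_rvD; first exact: mK.
  apply/measurable_rvZ/measurable_rv_sum => j' j'js.
  have mX1 := mK _ mX.
  apply: measurable_rvB; last exact: (measurable_oracle_mean (oG j') mX1).
  apply: (measurable_oracle (oG j') mX1).
  apply: (@measurable_fun_cylinders _ _ _ _ _ sample K (k.+1, j')).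
  by rewrite mem_cat (map_f (fun j => (k.+1, j)) j'js).
- exact: mK.
rewrite -natr1 mulrDl mul1r EFinD addeA leeD2r//; exact: IH.
Qed.

End sampling.

Lemma measurable_sgr (R : realType) (dT : measure_display)
    (T : measurableType dT) (f : T -> R) :
  measurable_fun setT f -> measurable_fun setT (fun w => Num.sg (f w)).
Proof.
move=> mf; apply: (@measurableT_comp _ _ _ _ _ _ (@Num.sg R) _ f) => //.
apply: nondecreasing_measurable => // x y xy.
case: (ltgtP x 0) xy => [x0|x0|->] xy; case: (ltgtP y 0) => [y0|y0|y0];
  rewrite ?(ltr0_sg x0) ?(gtr0_sg x0) ?(ltr0_sg y0) ?(gtr0_sg y0) ?y0 ?sgr0;
  lra.
Qed.

(** * Trajectories of Dis-Lion *)

Section dis_lion.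
Context (R : realType) (d n : nat).

Lemma lion_stateS (Xi : Type)
    (G : 'I_n -> 'rV[R]_d -> Xi -> 'rV[R]_d) (samp : nat -> 'I_n -> Xi)
    (x1 : 'rV[R]_d) (beta1 beta2 eta lambda : R) (k : nat) :
  lion_state G samp x1 beta1 beta2 eta lambda k.+2 =
  let: (x, m) := lion_state G samp x1 beta1 beta2 eta lambda k.+1 in
  let g := fun j => G j x (samp k.+2 j) in
  (x - eta *: (signv (\sum_(j < n) ((1 - beta1) *: m j + beta1 *: g j))
               + lambda *: x),
   fun j => (1 - beta2) *: m j + beta2 *: g j).
Proof. by []. Qed.

(** The space [T] is arbitrary so that it may be Omega with the sigma-algebra of the past samples;
    this yields adaptedness of the iterates. *)
Lemma measurable_lion_state (dX dT : measure_display)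
    (Xi : measurableType dX) (T : measurableType dT)
    (D : 'I_n -> probability Xi R) (sigma : R)
    (gf : 'I_n -> 'rV[R]_d -> 'rV[R]_d)
    (G : 'I_n -> 'rV[R]_d -> Xi -> 'rV[R]_d) (samp : nat -> 'I_n -> T -> Xi)
    (x1 : 'rV[R]_d) (beta1 beta2 eta lambda : R) (k : nat) :
  let st w := lion_state G (fun t j => samp t j w) x1 beta1 beta2 eta lambda k in
  (forall j, unbiased_oracle (D j) sigma (gf j) (G j)) ->
  (forall s j, (1 <= s <= k)%N -> measurable_fun setT (samp s j)) ->
  measurable_rv (fun w => (st w).1) /\
  forall j, measurable_rv (fun w => (st w).2 j).
Proof.
move=> /= oG; set X := fun k w => (lion_state G (fun t j => samp t j w)
  x1 beta1 beta2 eta lambda k).1; set M := fun k w => (lion_state G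
  (fun t j => samp t j w) x1 beta1 beta2 eta lambda k).2.
have step (x v : T -> 'rV[R]_d) : measurable_rv x -> measurable_rv v ->
    measurable_rv (fun w => x w - eta *: (signv (v w) + lambda *: x w)).
  move=> mx mv; apply: measurable_rvB => //; apply: measurable_rvZ.
  apply: measurable_rvD; last exact: measurable_rvZ.
  by move=> i; under eq_fun do rewrite mxE; exact: measurable_sgr.
rewrite -/(X k) -/(M k).
elim: k => [|[|k] IH] ms.
- by split=> [|j]; [exact: (measurable_rv_cst x1)|exact: (measurable_rv_cst 0)].
- have mg j : measurable_rv (fun w => G j x1 (samp 1%N j w)).
    apply: (measurable_oracle (oG j) (X := fun=> x1)); last exact: ms.
    exact: (measurable_rv_cst x1).
  split=> //.
  apply: (step (fun=> x1)); first exact: (measurable_rv_cst x1).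
  by apply: measurable_rv_sum => j _; exact: mg.
- have [|mX mM] := IH.
    by move=> s j /andP[s1 sk]; apply: ms; rewrite s1 (leqW sk).
  have mg j : measurable_rv (fun w => G j (X k.+1 w) (samp k.+2 j w)).
    by apply: (measurable_oracle (oG j)) => //; apply: ms; rewrite leqnn.
  have XS w : X k.+2 w = X k.+1 w - eta *: (signv (\sum_(j < n)
      ((1 - beta1) *: M k.+1 w j + beta1 *: G j (X k.+1 w) (samp k.+2 j w)))
      + lambda *: X k.+1 w).
    by rewrite /X /M lion_stateS; case: (lion_state _ _ _ _ _ _ _ k.+1).
  have MS w j : M k.+2 w j = (1 - beta2) *: M k.+1 w j +
      beta2 *: G j (X k.+1 w) (samp k.+2 j w).
    by rewrite /X /M lion_stateS; case: (lion_state _ _ _ _ _ _ _ k.+1).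
  split=> [|j].
    rewrite (funext XS).
    apply: (step (X k.+1) (fun w => \sum_(j < n) ((1 - beta1) *: M k.+1 w j
      + beta1 *: G j (X k.+1 w) (samp k.+2 j w)))) => //.
    apply: measurable_rv_sum => j _.
    exact: (measurable_rvD (measurable_rvZ _ (mM j)) (measurable_rvZ _ (mg j))).
  rewrite (funext (fun w => MS w j)).
  exact: (measurable_rvD (measurable_rvZ _ (mM j)) (measurable_rvZ _ (mg j))).
Qed.

End dis_lion.

(** * Pathwise estimates *)

Section euclidean.
Context (R : realType) (d : nat).
Implicit Types u v : 'rV[R]_d.

Lemma sqnormZ (c : R) v : sqnorm (c *: v) = c ^+ 2 * sqnorm v.
Proof.
by rewrite /sqnorm mulr_sumr; apply: eq_bigr => i _; rewrite mxE exprMn.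
Qed.

Lemma sqnormN v : sqnorm (- v) = sqnorm v.
Proof. by apply: eq_bigr => i _; rewrite mxE sqrrN. Qed.

Lemma sqnorm_lipschitz (L : R) u v :
  enorm u <= L * enorm v -> sqnorm u <= L ^+ 2 * sqnorm v.
Proof.
move=> uv; rewrite -!enorm_sqr -exprMn lerXn2r// nnegrE ?sqrtr_ge0//.
exact: le_trans (sqrtr_ge0 _) uv.
Qed.

Lemma sqnormD_young (b : R) u v : 0 < b ->
  sqnorm (u + v) <= (1 + b) * sqnorm u + (1 + b^-1) * sqnorm v.
Proof.
move=> b0; rewrite /sqnorm !mulr_sumr -big_split; apply: ler_sum => i _ /=.
rewrite mxE -subr_ge0.
suff -> : (1 + b) * u 0 i ^+ 2 + (1 + b^-1) * v 0 i ^+ 2 - (u 0 i + v 0 i) ^+ 2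
    = b^-1 * (b * u 0 i - v 0 i) ^+ 2.
  by rewrite mulr_ge0 ?sqr_ge0// invr_ge0 ltW.
by field; rewrite gt_eqF.
Qed.

Lemma sqnormD3 u v w :
  sqnorm (u + v + w) <= 3 * (sqnorm u + sqnorm v + sqnorm w).
Proof.
rewrite /sqnorm -!big_split mulr_sumr; apply: ler_sum => i _ /=; rewrite !mxE.
have := sqr_ge0 (u 0 i - v 0 i); have := sqr_ge0 (u 0 i - w 0 i).
have := sqr_ge0 (v 0 i - w 0 i); nra.
Qed.

(** Jensen's inequality, from the nonnegativity of the empirical variance in each coordinate. *)
Lemma sqnorm_mean (n : nat) (a : 'I_n -> 'rV[R]_d) : (0 < n)%N ->
  sqnorm (n%:R^-1 *: \sum_(j < n) a j) <= n%:R^-1 * \sum_(j < n) sqnorm (a j).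
Proof.
move=> n0; have nR : 0 < n%:R :> R by rewrite ltr0n.
rewrite /sqnorm exchange_big mulr_sumr; apply: ler_sum => i _ /=.
rewrite mxE summxE; set m := _ * _.
have sumE : \sum_(j < n) a j 0 i = n%:R * m by rewrite mulVKf// gt_eqF.
have : 0 <= \sum_(j < n) (a j 0 i - m) ^+ 2.
  by apply: sumr_ge0 => j _; exact: sqr_ge0.
have -> : \sum_(j < n) (a j 0 i - m) ^+ 2 =
    \sum_(j < n) a j 0 i ^+ 2 - n%:R * m ^+ 2.
  under eq_bigr do rewrite sqrrB.
  rewrite !big_split /= sumr_const card_ord sumrN sumrMnl -mulr_suml sumE.
  by rewrite -mulr_natr; ring.
by rewrite ler_pdivlMl// subr_ge0.
Qed.

(** Young's inequality in each coordinate with weight [rho / sqrt d]; the [d] constants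
    [rho / (2 sqrt d)] add up to [sqrt d * rho / 2]. *)
Lemma norm1_young (rho : R) v : (0 < d)%N -> 0 < rho ->
  norm1 v <= Num.sqrt d%:R * (sqnorm v / (2 * rho) + rho / 2).
Proof.
move=> d0 rho0; set s := Num.sqrt d%:R.
have s0 : 0 < s by rewrite sqrtr_gt0 ltr0n.
have sd : d%:R = s ^+ 2 by rewrite sqr_sqrtr// ler0n.
have -> : s * (sqnorm v / (2 * rho) + rho / 2) =
    \sum_(i < d) (s * v 0 i ^+ 2 / (2 * rho) + rho / (2 * s)).
  rewrite big_split /= sumr_const card_ord -[_ *+ d]mulr_natr sd -mulr_suml -mulr_sumr.
  by rewrite /sqnorm; field; rewrite !gt_eqF.
apply: ler_sum => i _; rewrite -subr_ge0.
have -> : s * v 0 i ^+ 2 / (2 * rho) + rho / (2 * s) - `|v 0 i| =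
    (s * `|v 0 i| - rho) ^+ 2 / (2 * rho * s).
  by rewrite -(real_normK (num_real (v 0 i))); field; rewrite !gt_eqF.
by rewrite divr_ge0 ?sqr_ge0// !mulr_ge0// ltW.
Qed.

End euclidean.

(** * Quadratic upper bound from a Lipschitz gradient *)

Section smoothness.
Context (R : realType) (d : nat).

(* Young's inequality instead of Cauchy-Schwarz: L^2 + 1 replaces L, which is
   harmless for the rate and works for every sign of L. *)
Lemma smooth_upper_bound (L : R) (f : 'rV[R]_d -> R) (gf : 'rV[R]_d -> 'rV[R]_d)
    (x v : 'rV[R]_d) :
  has_gradient f gf ->
  (forall x y, enorm (gf x - gf y) <= L * enorm (x - y)) ->
  f (x + v) <= f x + dotv (gf x) v + (L ^+ 2 + 1) / 2 * sqnorm v.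
Proof.
move=> gradf lip; pose phi (s : R) := f (x + s *: v).
have dphi (s : R) : is_derive s 1 phi (dotv (gf (x + s *: v)) v).
  have [df dfE] := gradf (x + s *: v).
  have dl : is_diff s (fun s : R => x + s *: v) (fun s => s *: v).
    rewrite (_ : (fun s => s *: v) = 0 + *:%R^~ v); last first.
      by apply/funext => t; rewrite /= fctE add0r.
    exact: is_diffD.
  have dc : differentiable phi s.
    by apply: differentiable_comp => //; exact: df.
  apply: DeriveDef; first exact/derivable1_diffP.
  rewrite deriveE// /phi (_ : (fun s => _) = f \o (fun s : R => x + s *: v))//.
  by rewrite diff_comp//= diff_val /= scale1r dfE.
(* A single intermediate point [c] on the segment suffices: the gradient gap there carries a factor
   [c^2 <= 1]. *)
have [c /andP[]] := @MVT R phi (fun s => dotv (gf (x + s *: v)) v) 0 1 ltr01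
  (fun s _ => dphi s) (derivable_within_continuous
    (fun s _ => @ex_derive _ _ _ _ _ _ _ (dphi s))).
rewrite !bnd_simp => c0 c1; rewrite /phi scale0r addr0 scale1r subr0 mulr1 => fE.
have {fE} -> : f (x + v) = f x + dotv (gf (x + c *: v)) v.
  by rewrite -fE [RHS]addrC subrK.
rewrite -addrA lerD2l.
have lc : sqnorm (gf (x + c *: v) - gf x) <= L ^+ 2 * sqnorm v.
  apply: le_trans (sqnorm_lipschitz (lip _ _)) _.
  rewrite addrAC subrr add0r sqnormZ ler_wpM2l ?sqr_ge0//.
  by rewrite ler_piMl ?sqnorm_ge0// expr_le1// ltW.
have : dotv (gf (x + c *: v)) v <= dotv (gf x) v +
    (sqnorm (gf (x + c *: v) - gf x) + sqnorm v) / 2.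
  rewrite /dotv /sqnorm -big_split /= mulr_suml -big_split; apply: ler_sum => i _ /=.
  rewrite !mxE; set a := gf _ 0 i; set b := gf _ 0 i.
  have := sqr_ge0 (a - b - v 0 i); nra.
move=> /le_trans; apply; rewrite lerD2l; lra.
Qed.

End smoothness.

(** * Descent of sign steps with weight decay *)

Section sign_descent.
Context (R : realType) (d : nat) (eta lambda : R).
Hypothesis eta0 : 0 < eta.

Let sgr_cases (a : R) :
  [\/ a < 0 /\ Num.sg a = -1, a = 0 /\ Num.sg a = 0 | 0 < a /\ Num.sg a = 1].
Proof.
case: (ltgtP a 0) => a0.
- by apply: Or31; rewrite ltr0_sg.
- by apply: Or33; rewrite gtr0_sg.
- by apply: Or32; rewrite a0 sgr0.
Qed.

(* A wrong or zero sign of u at a coordinate forces |g_i| <= |g_i - u_i|. *)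
Lemma dotv_sign_step (g u x : 'rV[R]_d) :
  (forall i, `|lambda * x 0 i| <= 2^-1) ->
  dotv g (- (eta *: (signv u + lambda *: x))) <=
    - (eta / 2 * norm1 g) + 2 * eta * norm1 (g - u).
Proof.
move=> lx; rewrite /dotv /norm1 !mulr_sumr -sumrN -big_split.
apply: ler_sum => i _ /=; rewrite !mxE.
move: (lx i); set y := lambda * _; set a := g 0 i; set b := u 0 i => ly.
(* In every sign case [a * sg b] is at least [|a| - 2 |a - b|], and the decay term costs at most
   [|a| / 2]. *)
suff H : 0 <= a * (Num.sg b + y) - `|a| / 2 + 2 * `|a - b|.
  have := mulr_ge0 (ltW eta0) H; nra.
have ay : - (`|a| / 2) <= a * y.
  rewrite lerNl -mulrN; apply: le_trans (ler_norm _) _.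
  by rewrite normrM normrN ler_wpM2l.
have [Hab Hba] : b - a <= `|a - b| /\ a - b <= `|a - b|.
  by rewrite {1}distrC !ler_norm.
have ab0 := normr_ge0 (a - b).
rewrite mulrDr.
case: (ler0P a) ay => a0 ay; case: (sgr_cases b) => -[b0 ->]; nra.
Qed.

(** Sign plus decay is at most 3/2 in absolute value per coordinate, whence 9/4. *)
Lemma sqnorm_sign_step (u x : 'rV[R]_d) :
  (forall i, `|lambda * x 0 i| <= 2^-1) ->
  sqnorm (- (eta *: (signv u + lambda *: x))) <= 9 / 4 * eta ^+ 2 * d%:R.
Proof.
move=> lx; rewrite sqnormN sqnormZ.
have -> : 9 / 4 * eta ^+ 2 * d%:R = eta ^+ 2 * (9 / 4 * d%:R) by ring.
rewrite ler_wpM2l ?sqr_ge0//.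
rewrite mulr_natr -[X in _ *+ X]card_ord -sumr_const.
apply: ler_sum => i _; rewrite !mxE.
move: (lx i); set y := lambda * _; set b := u 0 i; rewrite ler_norml => /andP[].
by case: (sgr_cases b) => -[b0 ->]; nra.
Qed.

Context (T : nat) (x u : nat -> 'rV[R]_d).
Hypothesis lambda0 : 0 <= lambda.
Hypothesis lambdaT : lambda <= (2 * eta * T%:R)^-1.
Hypothesis x0 : forall i, `|x 0 0 i| <= eta.
Hypothesis xS :
  forall k, x k.+1 = x k - eta *: (signv (u k) + lambda *: x k).

(** The factor [1 - lambda * eta] lies in [0, 1], so a coordinate grows by at most [eta] per step
    and stays below [eta * (k + 1) <= eta * T]. *)
Lemma decay_bound (k : nat) (i : 'I_d) : (k < T)%N -> `|lambda * x k 0 i| <= 2^-1.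
Proof.
move=> kT; have T0 : 0 < T%:R :> R by rewrite ltr0n (leq_ltn_trans _ kT).
have lT : lambda * (eta * T%:R) <= 2^-1.
  rewrite -ler_pdivlMr ?mulr_gt0// (le_trans lambdaT)//.
  by rewrite -mulrA invfM.
have le1 : lambda * eta <= 1.
  have : 1 <= T%:R :> R by rewrite ler1n; apply: leq_ltn_trans kT.
  have := mulr_ge0 lambda0 (ltW eta0); nra.
have xk : `|x k 0 i| <= eta * k.+1%:R.
  elim: k {kT} => [|k IH]; first by rewrite mulr1.
  rewrite xS !mxE; set y := x k 0 i in IH *; set b := u k 0 i.
  have -> : y - eta * (Num.sg b + lambda * y) =
      (1 - lambda * eta) * y - eta * Num.sg b by ring.
  apply: le_trans (ler_normB _ _) _; rewrite !normrM.
  rewrite (ger0_norm (x := 1 - _)) ?subr_ge0// (gtr0_norm eta0).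
  have sb : `|Num.sg b| <= 1 by rewrite normr_sg lern1 leq_b1.
  have := normr_ge0 y; have := mulr_ge0 lambda0 (ltW eta0).
  rewrite -[k.+2%:R]natr1 mulrDr mulr1 => le0 y0.
  apply: lerD; last by rewrite ler_piMr// ltW.
  by apply: le_trans IH; rewrite ler_piMl// lerBlDr lerDl.
rewrite normrM ger0_norm//; apply: le_trans lT; rewrite ler_wpM2l//.
by apply: le_trans xk _; rewrite ler_wpM2l ?ler_nat// ltW.
Qed.

Lemma sqnorm_step (k : nat) : (k < T)%N ->
  sqnorm (x k.+1 - x k) <= 9 / 4 * eta ^+ 2 * d%:R.
Proof.
move=> kT; rewrite xS addrAC subrr add0r.
by apply: sqnorm_sign_step => i; exact: decay_bound.
Qed.

(** The one-step descent inequality is scaled by [2 / eta] and telescoped; [Delta] bounds the total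
    decrease of [F]. *)
Lemma sum_norm1_gradient (F : 'rV[R]_d -> R) (gF : 'rV[R]_d -> 'rV[R]_d)
    (Q Delta : R) :
  (0 <= Q) ->
  (forall x v, F (x + v) <= F x + dotv (gF x) v + Q / 2 * sqnorm v) ->
  (forall y, F (x 0%N) - F y <= Delta) ->
  \sum_(k < T) norm1 (gF (x k)) <=
    2 * Delta / eta + 4 * \sum_(k < T) norm1 (gF (x k) - u k) +
    9 / 4 * Q * eta * d%:R * T%:R.
Proof.
move=> Q0 Fsm FD.
have descent k : (k < T)%N -> norm1 (gF (x k)) <=
    2 / eta * (F (x k) - F (x k.+1)) + 4 * norm1 (gF (x k) - u k)
    + 9 / 4 * Q * eta * d%:R.
  move=> kT; have lx i := decay_bound i kT.
  have D1 := Fsm (x k) (- (eta *: (signv (u k) + lambda *: x k))).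
  rewrite -xS in D1; have D2 := dotv_sign_step (gF (x k)) (u k) lx.
  have D3 := ler_wpM2l (divr_ge0 Q0 (ler0n R 2)) (sqnorm_sign_step (u k) lx).
  rewrite -(ler_pM2l (divr_gt0 eta0 (ltr0n R 2))).
  set N := norm1 _ in D2 *; set E := norm1 _ in D2 *.
  have -> : eta / 2 * (2 / eta * (F (x k) - F (x k.+1)) + 4 * E +
    9 / 4 * Q * eta * d%:R) = F (x k) - F (x k.+1) + 2 * eta * E +
    Q / 2 * (9 / 4 * eta ^+ 2 * d%:R) by field; rewrite gt_eqF.
  lra.
apply: (@le_trans _ _ (\sum_(k < T) (2 / eta * (F (x k) - F (x k.+1)) +
    4 * norm1 (gF (x k) - u k) + 9 / 4 * Q * eta * d%:R))).
  by apply: ler_sum => k _; exact: descent.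
rewrite !big_split /= sumr_const card_ord -!mulr_sumr.
rewrite -[_ *+ T]mulr_natr !lerD2r.
have -> : \sum_(k < T) (F (x k) - F (x k.+1)) = F (x 0%N) - F (x T).
  rewrite -opprB -(telescope_sumr (fun k => F (x k)) (leq0n T)) big_mkord -sumrN.
  by apply: eq_bigr => k _; rewrite opprB.
by rewrite [2 * Delta / eta]mulrAC ler_wpM2l// divr_ge0// ltW.
Qed.

End sign_descent.

(** * Momentum recursion along one outcome *)

Section momentum.
Context (R : realType) (d : nat) (beta : R).

(** Young with weight [beta]: one factor [1 - beta] of the square absorbs [1 + beta], the other
    remains as contraction. *)
Lemma momentum_drift (e h : 'rV[R]_d) : 0 < beta <= 1 ->
  sqnorm ((1 - beta) *: (e + h)) <=
    (1 - beta) * sqnorm e + beta^-1 * sqnorm h.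
Proof.
move=> /andP[b0 b1]; rewrite sqnormZ.
have Y := sqnormD_young e h b0.
apply: le_trans (ler_wpM2l (sqr_ge0 _) Y) _; rewrite mulrDr !mulrA.
apply: lerD; apply: ler_wpM2r; rewrite ?sqnorm_ge0//; first nra.
rewrite -subr_ge0.
have -> : beta^-1 - (1 - beta) ^+ 2 * (1 + beta^-1) =
    (1 - (1 - beta) ^+ 2 * (1 + beta)) / beta by field; rewrite gt_eqF.
by rewrite divr_ge0 ?(ltW b0)//; nra.
Qed.

(** The error splits into old momentum error, gradient drift and fresh noise. Only the noise keeps
    its weight, [beta^2], to be compared with [beta2] later. *)
Lemma update_error (M g0 g1 h : 'rV[R]_d) : 0 <= beta <= 1 ->
  sqnorm ((1 - beta) *: M + beta *: h - g1) <=
    3 * (sqnorm (M - g0) + sqnorm (g0 - g1) + beta ^+ 2 * sqnorm (h - g1)).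
Proof.
move=> /andP[b0 b1].
have -> : (1 - beta) *: M + beta *: h - g1 = (1 - beta) *: (M - g0) +
    (1 - beta) *: (g0 - g1) + beta *: (h - g1).
  by apply/rowP => i; rewrite !mxE; ring.
apply: le_trans (sqnormD3 _ _ _) _; rewrite !sqnormZ ler_pM2l//.
have b2 : (1 - beta) ^+ 2 <= 1 by nra.
by rewrite lerD2r lerD// ler_piMl// sqnorm_ge0.
Qed.

End momentum.

(** * Expected gradient norm *)

Definition mean (R : realType) (d n : nat) (a : 'I_n -> 'rV[R]_d) : 'rV[R]_d :=
  n%:R^-1 *: \sum_(j < n) a j.

(** Carries a pathwise bound over to expectations; as all terms are nonnegative, no integrability
    has to be established. *)
Lemma ge0_integral_le_affine (R : realType) (dO : measure_display)
    (Omega : measurableType dO) (P : probability Omega R) (I : Type)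
    (s : seq I) (h : Omega -> R) (f : I -> Omega -> R) (c A : I -> R) (e : R) :
  measurable_fun setT h -> (forall i, measurable_fun setT (f i)) ->
  (forall w, 0 <= h w) -> (forall i w, 0 <= f i w) ->
  (forall i, 0 <= c i) -> 0 <= e ->
  (forall w, h w <= e + \sum_(i <- s) c i * f i w) ->
  (forall i, (\int[P]_w (f i w)%:E <= (A i)%:E)%E) ->
  (\int[P]_w (h w)%:E <= (e + \sum_(i <- s) c i * A i)%:E)%E.
Proof.
move=> mh mf h0 f0 c0 e0 hle fA.
have mcf i : measurable_fun setT (fun w => ((c i)%:E * (f i w)%:E)%E).
  by apply: emeasurable_funM => //; exact/measurable_EFinP.
have cf0 i w : (0 <= (c i)%:E * (f i w)%:E)%E.
  by rewrite -EFinM lee_fin mulr_ge0.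
apply: (@le_trans _ _ (\int[P]_w
    (cst e%:E w + \sum_(i <- s) (c i)%:E * (f i w)%:E))%E).
  apply: ge0_le_integral => //.
  - by move=> w _; rewrite lee_fin.
  - exact/measurable_EFinP.
  - by apply: emeasurable_funD => //; exact: emeasurable_sum.
  - by move=> w _; under eq_bigr do rewrite -EFinM; rewrite sumEFin -EFinD lee_fin.
rewrite ge0_integralD//; first last.
- exact: emeasurable_sum.
- by move=> w _; exact: sume_ge0.
rewrite integral_cst// [X in (_ * X)%E]probability_setT mule1 ge0_integral_sum//.
rewrite EFinD leeD2l// -sumEFin; apply: lee_sum => i _.
rewrite ge0_integralZl_EFin//; first last.
- exact/measurable_EFinP.
- by move=> w _; rewrite lee_fin.
by rewrite EFinM lee_wpmul2l// lee_fin.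
Qed.

Section convergence.
Context (R : realType) (d n T : nat) (dO dX : measure_display)
  (Omega : measurableType dO) (P : probability Omega R)
  (Xi : measurableType dX) (D : 'I_n -> probability Xi R)
  (f : 'I_n -> 'rV[R]_d -> R) (gf : 'I_n -> 'rV[R]_d -> 'rV[R]_d)
  (G : 'I_n -> 'rV[R]_d -> Xi -> 'rV[R]_d) (xi : nat -> 'I_n -> Omega -> Xi)
  (x1 : 'rV[R]_d) (beta1 beta2 eta lambda L sigma Delta : R).

Let F x := n%:R^-1 * \sum_(j < n) f j x.
Let gF x := n%:R^-1 *: \sum_(j < n) gf j x.

Hypothesis n0 : (0 < n)%N.
Hypothesis d0 : (0 < d)%N.
Hypothesis gradf : forall j, has_gradient (f j) (gf j).
Hypothesis lip : forall j x y, enorm (gf j x - gf j y) <= L * enorm (x - y).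
Hypothesis oG : forall j, unbiased_oracle (D j) sigma (gf j) (G j).
Hypothesis FD : forall x, F x1 - F x <= Delta.
Hypothesis xiP : indep_samples T P D xi.
Hypothesis beta2P : 0 < beta2 <= 1.
Hypothesis beta1P : 0 <= beta1 <= 1.
Hypothesis beta12 : beta1 ^+ 2 <= beta2.
Hypothesis eta0 : 0 < eta.
Hypothesis lambda0 : 0 <= lambda.
Hypothesis lambdaT : lambda <= (2 * eta * T%:R)^-1.
Hypothesis x1eta : normInf x1 <= eta.

Let nR : 0 < n%:R :> R. Proof. by rewrite ltr0n. Qed.

(* Indices are shifted by one: X k, gh k, u k and M k are x_(k+1), the averaged
   stochastic gradient, v_(k+1) / n and the averaged momentum m_(k+1). *)
Let st (k : nat) (w : Omega) :=
  lion_state G (fun t j => xi t j w) x1 beta1 beta2 eta lambda k.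
Let X k w := (st k w).1.
Let M k w := mean (st k.+1 w).2.
Let gh k w := mean (fun j => G j (X k w) (xi k.+1 j w)).
Let u k w :=
  if k is k'.+1 then (1 - beta1) *: M k' w + beta1 *: gh k w else gh 0 w.

Let signv_pscale (c : R) (v : 'rV[R]_d) : 0 < c -> signv (c *: v) = signv v.
Proof. by move=> c0; apply/rowP => i; rewrite !mxE sgrM gtr0_sg ?mul1r. Qed.

Let mean_lin (a b : R) (v w : 'I_n -> 'rV[R]_d) :
  mean (fun j => a *: v j + b *: w j) = a *: mean v + b *: mean w.
Proof.
by rewrite /mean big_split /= -!scaler_sumr scalerDr !scalerA !(mulrC n%:R^-1).
Qed.

Let stS k w : st k.+2 w =
  (X k.+1 w - eta *: (signv (\sum_(j < n) ((1 - beta1) *: (st k.+1 w).2 j +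
       beta1 *: G j (X k.+1 w) (xi k.+2 j w))) + lambda *: X k.+1 w),
   fun j => (1 - beta2) *: (st k.+1 w).2 j +
       beta2 *: G j (X k.+1 w) (xi k.+2 j w)).
Proof. by rewrite /X {1}/st lion_stateS -/(st k.+1 w); case: (st k.+1 w). Qed.

(** Dividing the server's sum by [n > 0] leaves its sign unchanged. *)
Let XS k w : X k.+1 w = X k w - eta *: (signv (u k w) + lambda *: X k w).
Proof.
have ninv : 0 < n%:R^-1 :> R by rewrite invr_gt0.
case: k => [|k]; first by rewrite /u /gh /mean signv_pscale.
by rewrite {1}/X stS /= /u /M /gh -mean_lin /mean signv_pscale.
Qed.

Let MS k w : M k.+1 w = (1 - beta2) *: M k w + beta2 *: gh k.+1 w.
Proof. by rewrite {1}/M stS /= mean_lin. Qed.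

Let F_smooth x v : F (x + v) <= F x + dotv (gF x) v + (L ^+ 2 + 1) / 2 * sqnorm v.
Proof.
rewrite /F -(ler_pM2l nR) !mulrDr !mulVKf ?gt_eqF//.
apply: (@le_trans _ _ (\sum_(j < n) (f j x + dotv (gf j x) v
    + (L ^+ 2 + 1) / 2 * sqnorm v))).
  by apply: ler_sum => j _; apply: smooth_upper_bound.
rewrite !big_split /= sumr_const card_ord -[_ *+ n]mulr_natl !lerD2r lerD2l.
rewrite /dotv exchange_big mulr_sumr /=; apply: ler_sum => i _.
by rewrite -mulr_suml mxE summxE !mulrA divff ?gt_eqF// mul1r.
Qed.

Let gF_lip x y : sqnorm (gF x - gF y) <= L ^+ 2 * sqnorm (x - y).
Proof.
rewrite /gF -scalerBr -sumrB; apply: le_trans (sqnorm_mean _ n0) _.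
rewrite ler_pdivrMl//; apply: (@le_trans _ _ (\sum_(j < n) L ^+ 2 * sqnorm (x - y))).
  by apply: ler_sum => j _; exact: sqnorm_lipschitz.
by rewrite sumr_const card_ord mulr_natl.
Qed.

Let x1_le w i : `|X 0 w 0 i| <= eta.
Proof.
by apply: le_trans x1eta; exact: (le_bigmax 0 (fun i => `|x1 0 i|)).
Qed.

(** With the shifted index, [X k] uses samples up to time [k] only, so the samples of time [k + 1]
    at which its gradient is estimated are fresh. *)
Let adaptedX k : adapted xi k (X k).
Proof.
move=> K hK; have [] // := @measurable_lion_state R d n dX _ Xi
  (g_sigma_algebraType (cylinders (fun k => xi k.1 k.2) K)) D sigma gf G xi
  x1 beta1 beta2 eta lambda k oG.
by move=> s j sk; apply: (@measurable_fun_cylinders _ _ _ _ _ _ K (s, j)); exact: hK.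
Qed.

Let adaptedM k : adapted xi k.+1 (M k).
Proof.
move=> K hK; have [|_ mM] := @measurable_lion_state R d n dX _ Xi
  (g_sigma_algebraType (cylinders (fun k => xi k.1 k.2) K)) D sigma gf G xi
  x1 beta1 beta2 eta lambda k.+1 oG.
  by move=> s j sk; apply: (@measurable_fun_cylinders _ _ _ _ _ _ K (s, j)); exact: hK.
by apply: measurable_rvZ; apply: measurable_rv_sum => j _; exact: mM.
Qed.

Let adapted_gF k (Y : Omega -> 'rV[R]_d) : adapted xi k Y -> adapted xi k (fun w => gF (Y w)).
Proof.
move=> aY K hK; apply: measurable_rvZ; apply: measurable_rv_sum => j _.
by apply: (measurable_oracle_mean (oG j)); exact: aY.
Qed.

Let adaptedS k (Y : Omega -> 'rV[R]_d) : adapted xi k Y -> adapted xi k.+1 Y.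
Proof.
by move=> aY K hK; apply: aY => s j /andP[s1 sk]; apply: hK; rewrite s1 leqW.
Qed.

Let H := L ^+ 2 * (9 / 4 * eta ^+ 2 * d%:R).

Let gF_step k w : (k < T)%N -> sqnorm (gF (X k w) - gF (X k.+1 w)) <= H.
Proof.
move=> kT; rewrite -sqnormN opprB; apply: le_trans (gF_lip _ _) _.
rewrite ler_wpM2l ?sqr_ge0//.
apply: (@sqnorm_step R d eta lambda eta0 T (X ^~ w) (u ^~ w)) => //.
Qed.

Let gh_noise k w : gh k w - gF (X k w) =
  n%:R^-1 *: \sum_(j < n) (G j (X k w) (xi k.+1 j w) - gf j (X k w)).
Proof. by rewrite /gh /mean /gF -scalerBr -sumrB. Qed.

(** Zero frozen part and [c = 1/n]: the [n] nodes contribute [sigma^2 / n^2] each. *)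
Let noise_bound k : (k < T)%N ->
  (\int[P]_w (sqnorm (gh k w - gF (X k w)))%:E <= (sigma ^+ 2 / n%:R)%:E)%E.
Proof.
move=> kT; have a0 : adapted xi k (fun=> 0 : 'rV[R]_d).
  by move=> K _; exact: measurable_rv_cst.
have := second_moment_nodes xiP oG n%:R^-1 kT a0 (adaptedX (k := k)).
under eq_integral do rewrite add0r -gh_noise.
move=> /le_trans; apply.
have -> : sqnorm (0 : 'rV[R]_d) = 0.
  by rewrite /sqnorm big1// => i _; rewrite mxE expr0n.
rewrite integral0 add0e lee_fin le_eqVlt; apply/orP; left; apply/eqP.
by field; rewrite gt_eqF.
Qed.

(** [b] solves [b (k+1) = (1 - beta2) * b k + B] exactly: the initial variance decays towards the
    fixed point [B / beta2]. *)
Let B := beta2^-1 * H + beta2 ^+ 2 * (sigma ^+ 2 / n%:R).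
Let b k := (1 - beta2) ^+ k * (sigma ^+ 2 / n%:R) + B / beta2.

Let H_ge0 : 0 <= H.
Proof.
rewrite /H mulr_ge0 ?sqr_ge0// mulr_ge0 ?ler0n// mulr_ge0 ?sqr_ge0//.
Qed.

Let b_ge0 k : 0 <= b k.
Proof.
have [b20 b21] := andP beta2P.
have sn : 0 <= sigma ^+ 2 / n%:R by rewrite divr_ge0 ?sqr_ge0.
have B0 : 0 <= B by rewrite addr_ge0// mulr_ge0 ?sqr_ge0 ?H_ge0// invr_ge0 ltW.
have c0 : 0 <= (1 - beta2) ^+ k by rewrite exprn_ge0// subr_ge0.
by apply: addr_ge0; [exact: mulr_ge0|rewrite divr_ge0// ltW].
Qed.

Let momentum_bound k : (k < T)%N ->
  (\int[P]_w (sqnorm (M k w - gF (X k w)))%:E <= (b k)%:E)%E.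
Proof.
have [b20 b21] := andP beta2P.
have sn : 0 <= sigma ^+ 2 / n%:R by rewrite divr_ge0 ?sqr_ge0.
have H0 := H_ge0.
have B0 : 0 <= B by rewrite addr_ge0// mulr_ge0 ?sqr_ge0// invr_ge0 ltW.
elim: k => [|k IH] kT.
  (* The initial momentum is the raw stochastic gradient, so [M 0] is [gh 0]. *)
  apply: le_trans (noise_bound kT) _.
  by rewrite lee_fin /b expr0 mul1r lerDl divr_ge0// ltW.
have kT' := ltnW kT.
(* [A] is the part of the next error already determined at time [k + 1]; the rest is noise of time
   [k + 2]. *)
pose A w := (1 - beta2) *: ((M k w - gF (X k w)) + (gF (X k w) - gF (X k.+1 w))).
have aA : adapted xi k.+1 A.
  move=> K hK; apply: measurable_rvZ; apply: measurable_rvD; apply: measurable_rvB.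
  - exact: adaptedM.
  - exact: (adaptedS (adapted_gF (adaptedX (k := k)))).
  - exact: (adaptedS (adapted_gF (adaptedX (k := k)))).
  - exact: (adapted_gF (adaptedX (k := k.+1))).
have := second_moment_nodes xiP oG (beta2 / n%:R) kT aA (adaptedX (k := k.+1)).
have AE w : A w + (beta2 / n%:R) *: \sum_(j < n)
    (G j (X k.+1 w) (xi k.+2 j w) - gf j (X k.+1 w)) = M k.+1 w - gF (X k.+1 w).
  rewrite -scalerA -gh_noise MS /A.
  by apply/rowP => i; rewrite !mxE; ring.
under eq_integral do rewrite AE.
move=> /le_trans; apply.
have mMX : measurable_rv (fun w => M k w - gF (X k w)).
  apply: measurable_rvB; apply: (@adapted_measurable _ _ _ T _ _ _ P _ D xi xiP k.+1) => //.
  exact: (adaptedS (adapted_gF (adaptedX (k := k)))).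
have mA : measurable_rv A.
  exact: (@adapted_measurable _ _ _ T _ _ _ P _ D xi xiP k.+1).
have b2c : 0 <= 1 - beta2 by rewrite subr_ge0.
have AH : (\int[P]_w (sqnorm (A w))%:E <=
    (beta2^-1 * H + \sum_(i <- [:: tt]) (1 - beta2) * b k)%:E)%E.
  apply: (@ge0_integral_le_affine _ _ _ P unit _ _
    (fun _ w => sqnorm (M k w - gF (X k w))) (fun=> 1 - beta2)) => //.
  - exact: measurable_sqnorm.
  - by move=> _; exact: measurable_sqnorm.
  - by move=> w; exact: sqnorm_ge0.
  - by move=> _ w; exact: sqnorm_ge0.
  - by rewrite mulr_ge0// invr_ge0 ltW.
  - move=> w; rewrite big_seq1 addrC.
    apply: le_trans (momentum_drift _ _ beta2P) _; rewrite lerD2l.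
    by rewrite ler_pM2l ?invr_gt0//; exact: gF_step.
  - by move=> _; exact: IH.
apply: le_trans (leeD2r _ AH) _; rewrite big_seq1.
rewrite -EFinD lee_fin le_eqVlt; apply/orP; left; apply/eqP.
rewrite /b /B (exprS _ k); move: ((1 - beta2) ^+ k) H => c h.
by field; rewrite !gt_eqF.
Qed.

(** [u k] is built on the preceding momentum, hence [k.-1]; at [k = 0] this reads [b 0], which fits
    since [u 0] is [M 0]. *)
Let r k := 3 * (b k.-1 + H + beta2 * (sigma ^+ 2 / n%:R)).

Let measurable_gF k : (k <= T)%N -> measurable_rv (fun w => gF (X k w)).
Proof.
move=> kT; apply: (@adapted_measurable _ _ _ T _ _ _ P _ D xi xiP k) => //.
exact: (adapted_gF (adaptedX (k := k))).
Qed.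

Let measurable_M k : (k < T)%N -> measurable_rv (M k).
Proof.
by move=> kT; exact: (@adapted_measurable _ _ _ T _ _ _ P _ D xi xiP k.+1).
Qed.

Let measurable_gh k : (k < T)%N -> measurable_rv (gh k).
Proof.
move=> kT; apply: measurable_rvZ; apply: measurable_rv_sum => j _.
apply: (measurable_oracle (oG j)).
  apply: (@adapted_measurable _ _ _ T _ _ _ P _ D xi xiP k) => //.
  exact: ltnW.
by case: xiP => mxi _; exact: mxi.
Qed.

Let measurable_u k : (k < T)%N -> measurable_rv (u k).
Proof.
case: k => [|k] kT; first exact: measurable_gh.
apply: measurable_rvD; apply: measurable_rvZ; last exact: measurable_gh.
exact: measurable_M (ltnW kT).
Qed.

Let update_bound k : (k < T)%N ->
  (\int[P]_w (sqnorm (gF (X k w) - u k w))%:E <= (r k)%:E)%E.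
Proof.
move=> kT; under eq_integral do rewrite -sqnormN opprB.
have sn : 0 <= sigma ^+ 2 / n%:R by rewrite divr_ge0 ?sqr_ge0.
have H0 := H_ge0.
case: k kT => [|k] kT.
  apply: le_trans (momentum_bound kT) _; rewrite lee_fin /r /=.
  have := mulr_ge0 (ltW (andP beta2P).1) sn; have := b_ge0 0%N; lra.
have [b20 _] := andP beta2P.
have kT' := ltnW kT.
(* The index [true] stands for the momentum error, [false] for the fresh noise. *)
apply: (@le_trans _ _ (3 * H + \sum_(i <- [:: true; false])
    (if i then 3 else 3 * beta1 ^+ 2) * (if i then b k else sigma ^+ 2 / n%:R))%:E).
  apply: (@ge0_integral_le_affine _ _ _ P bool _ _
    (fun i w => if i then sqnorm (M k w - gF (X k w))
                else sqnorm (gh k.+1 w - gF (X k.+1 w)))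
    (fun i => if i then 3 else 3 * beta1 ^+ 2)) => //.
  - apply: measurable_sqnorm; apply: measurable_rvB; last exact: measurable_gF.
    exact: (measurable_u kT).
  - case; apply: measurable_sqnorm; apply: measurable_rvB => //.
    + exact: measurable_M.
    + exact: measurable_gF (ltnW _).
    + exact: measurable_gh.
    + exact: measurable_gF.
  - by move=> w; exact: sqnorm_ge0.
  - by case=> w; exact: sqnorm_ge0.
  - by case => /=; [exact: ler0n|exact: mulr_ge0 (ler0n _ _) (sqr_ge0 _)].
  - by rewrite mulr_ge0.
  - move=> w; rewrite !big_cons big_nil /=.
    apply: le_trans (update_error (M k w) (gF (X k w)) (gF (X k.+1 w)) (gh k.+1 w) beta1P) _.
    have := gF_step w kT'; lra.
  - by case; [exact: momentum_bound|exact: noise_bound].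
rewrite lee_fin !big_cons big_nil /r /=.
have := ler_wpM2r sn beta12; lra.
Qed.

(** Because of [k.-1] the first geometric term is counted twice, giving
    [1 + 1 / beta2 <= 2 / beta2]. *)
Let sum_b : (0 < T)%N ->
  \sum_(k < T) b k.-1 <= 2 / beta2 * (sigma ^+ 2 / n%:R) + T%:R * (B / beta2).
Proof.
have [b20 b21] := andP beta2P; move=> T0.
have sn : 0 <= sigma ^+ 2 / n%:R by rewrite divr_ge0 ?sqr_ge0.
rewrite big_split /= sumr_const card_ord -[_ *+ T]mulr_natl lerD2r -mulr_suml.
rewrite ler_wpM2r//.
have geo m : \sum_(k < m) (1 - beta2) ^+ k <= beta2^-1.
  rewrite -(ler_pM2l b20) divff ?gt_eqF//.
  have -> : beta2 * \sum_(k < m) (1 - beta2) ^+ k = 1 - (1 - beta2) ^+ m.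
    by apply: oppr_inj; rewrite opprB subrX1 -mulNr; congr (_ * _); ring.
  by rewrite gerBl exprn_ge0// subr_ge0.
case: T T0 => // m _; rewrite big_ord_recl expr0 /=.
have := geo m; have : 1 <= beta2^-1 by rewrite invf_ge1.
lra.
Qed.

Lemma sum_gradient_bound (rho : R) : (0 < T)%N -> 0 < rho ->
  (\sum_(k < T) \int[P]_w (norm1 (gF (X k w)))%:E <=
   (2 * Delta / eta + 9 / 4 * (L ^+ 2 + 1) * eta * d%:R * T%:R +
    4 * T%:R * (Num.sqrt d%:R * (rho / 2)) +
    4 * Num.sqrt d%:R / (2 * rho) *
    (3 * (2 / beta2 * (sigma ^+ 2 / n%:R) + T%:R * (B / beta2) + T%:R * H +
          T%:R * (beta2 * (sigma ^+ 2 / n%:R)))))%:E)%E.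
Proof.
(* [e] collects the deterministic terms and [c1] is the weight of the squared errors after Young. *)
move=> T0 rho0; set c1 := 4 * _ / _; set e := _ + _ + 4 * _ * _.
have s0 : 0 <= Num.sqrt d%:R :> R := sqrtr_ge0 _.
have c10 : 0 <= c1 by rewrite divr_ge0 ?mulr_ge0// ltW.
have Delta0 : 0 <= Delta by rewrite -(subrr (F x1)).
have Q0 : 0 <= L ^+ 2 + 1 by rewrite addr_ge0 ?sqr_ge0.
have e0 : 0 <= e.
  rewrite /e; apply: addr_ge0; first apply: addr_ge0.
  - by rewrite divr_ge0 ?mulr_ge0// ltW.
  - by rewrite !mulr_ge0 ?invr_ge0// ltW.
  - by rewrite !mulr_ge0 ?invr_ge0// ltW.
have mg k : (k < T)%N -> measurable_fun setT (fun w => norm1 (gF (X k w))).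
  move=> kT; apply: measurable_sum => i.
  apply: measurableT_comp; first exact: normr_measurable.
  exact: measurable_gF (ltnW kT) i.
rewrite -ge0_integral_sum//; first last.
- by move=> k w _; rewrite lee_fin sumr_ge0.
- by move=> k; apply/measurable_EFinP/mg.
under eq_integral do rewrite sumEFin.
apply: (@le_trans _ _ (e + \sum_(k < T) c1 * r k)%:E).
  apply: (@ge0_integral_le_affine _ _ _ P 'I_T _ _
    (fun k w => sqnorm (gF (X k w) - u k w)) (fun=> c1)) => //.
  - by apply: measurable_sum => k; exact: mg.
  - move=> k; apply/measurable_sqnorm/measurable_rvB; last exact: measurable_u.
    exact: measurable_gF (ltnW _).
  - by move=> w; rewrite sumr_ge0// => k _; rewrite sumr_ge0.
  - by move=> k w; exact: sqnorm_ge0.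
  - move=> w; have := @sum_norm1_gradient R d eta lambda eta0 T (X ^~ w) (u ^~ w)
      lambda0 lambdaT (x1_le w) (XS ^~ w) F gF _ Delta Q0 F_smooth FD.
    move=> /le_trans; apply.
    have Y : \sum_(k < T) norm1 (gF (X k w) - u k w) <= \sum_(k < T)
        (Num.sqrt d%:R / (2 * rho) * sqnorm (gF (X k w) - u k w) +
         Num.sqrt d%:R * (rho / 2)).
      apply: ler_sum => k _; apply: le_trans (norm1_young _ d0 rho0) _.
      by rewrite mulrDr mulrCA mulrC.
    rewrite big_split /= sumr_const card_ord -[_ *+ T]mulr_natl -mulr_sumr in Y.
    rewrite -mulr_sumr /e /c1; set S := \sum_(k < T) sqnorm _ in Y *.
    have -> : 4 * Num.sqrt d%:R / (2 * rho) * S =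
      4 * (Num.sqrt d%:R / (2 * rho) * S) by rewrite !mulrA.
    lra.
  - by move=> k; exact: update_bound.
rewrite lee_fin lerD2l -mulr_sumr ler_wpM2l// /r -mulr_sumr ler_pM2l//.
rewrite big_split /= big_split /= !sumr_const card_ord.
rewrite -[H *+ T]mulr_natl -[(beta2 * _) *+ T]mulr_natl !lerD2r; exact: sum_b.
Qed.

End convergence.

(** * Substitution of the parameters and the final rate *)

(* Here p = n^(1/4), q = T^(1/4) and s = sqrt d. *)
Lemma rate_bound (R : realFieldType) (p q s c ceta L sigma Delta : R) :
  1 <= p <= q -> 0 < s -> 0 < c -> 0 < ceta -> 0 <= Delta ->
  let n := p ^+ 4 in let T := q ^+ 4 in let rho := (p * q)^-1 in
  let beta2 := c * (p ^+ 2 / q ^+ 2) in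
  let eta := ceta * p / (s * q ^+ 3) in
  let H := L ^+ 2 * (9 / 4 * eta ^+ 2 * s ^+ 2) in
  let B := beta2^-1 * H + beta2 ^+ 2 * (sigma ^+ 2 / n) in
  T^-1 * (2 * Delta / eta + 9 / 4 * (L ^+ 2 + 1) * eta * s ^+ 2 * T +
    4 * T * (s * (rho / 2)) + 4 * s / (2 * rho) *
    (3 * (2 / beta2 * (sigma ^+ 2 / n) + T * (B / beta2) + T * H +
          T * (beta2 * (sigma ^+ 2 / n))))) <=
  (2 * Delta / ceta + 9 / 4 * (L ^+ 2 + 1) * ceta + 2 +
   6 * (2 * sigma ^+ 2 / c + 9 / 4 * L ^+ 2 * ceta ^+ 2 / c ^+ 2 +
        9 / 4 * L ^+ 2 * ceta ^+ 2 + 2 * c * sigma ^+ 2)) * s / (p * q).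
Proof.
move=> /andP[p1 pq] s0 c0 ceta0 D0; cbv zeta.
have p0 : 0 < p by lra.
have q0 : 0 < q by lra.
pose z := p / q; pose y := p^-1.
have z01 : 0 <= z <= 1.
  by rewrite /z divr_ge0 ?(ltW p0) ?(ltW q0)//= ler_pdivrMr// mul1r.
have y01 : 0 <= y <= 1 by rewrite /y invr_ge0 (ltW p0) invf_le1.
have zn k : z ^+ k <= 1 by case/andP: z01 => z0 z1; rewrite exprn_ile1.
have yn k : y ^+ k <= 1 by case/andP: y01 => y0 y1; rewrite exprn_ile1.
(* An exact identity: every term is [s / (p q)] times a constant and a power of [z = p / q] or
   [y = 1 / p], both at most 1. *)
rewrite [leLHS](_ : _ = (2 * Delta / ceta +
    9 / 4 * (L ^+ 2 + 1) * ceta * z ^+ 2 + 2 + 6 * (2 * sigma ^+ 2 / c * y ^+ 4 +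
      9 / 4 * L ^+ 2 * ceta ^+ 2 / c ^+ 2 + 9 / 4 * L ^+ 2 * ceta ^+ 2 * z ^+ 4
      + 2 * c * sigma ^+ 2)) * s / (p * q)); last first.
  rewrite /z /y; field.
  by rewrite !gt_eqF.
rewrite ler_pdivrMr ?mulr_gt0// divfK ?gt_eqF ?mulr_gt0// ler_pM2r//.
have le1 (a t : R) : 0 <= a -> t <= 1 -> a * t <= a.
  by move=> a0 t1; rewrite ler_piMr.
have L0 : 0 <= L ^+ 2 := sqr_ge0 _; have S0 : 0 <= sigma ^+ 2 := sqr_ge0 _.
have := le1 (9 / 4 * (L ^+ 2 + 1) * ceta) _ _ (zn 2%N).
have := le1 (2 * sigma ^+ 2 / c) _ _ (yn 4%N).
have := le1 (9 / 4 * L ^+ 2 * ceta ^+ 2) _ _ (zn 4%N).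
move=> H1 H2 H3.
have {}H1 := H1 (mulr_ge0 (mulr_ge0 (divr_ge0 (ler0n _ 9) (ler0n _ 4)) L0) (sqr_ge0 _)).
have {}H2 := H2 (divr_ge0 (mulr_ge0 (ler0n _ 2) S0) (ltW c0)).
have {}H3 := H3 (mulr_ge0 (mulr_ge0 (divr_ge0 (ler0n _ 9) (ler0n _ 4))
  (addr_ge0 L0 ler01)) (ltW ceta0)).
lra.
Qed.

(** Turns real exponents into natural powers of fourth roots, so that the rate becomes a rational
    identity. *)
Lemma powR_quarter (R : realType) (a : R) (k : nat) : 0 <= a ->
  a `^ (k%:R / 4%:R) = (a `^ (4%:R^-1)) ^+ k.
Proof. by move=> a0; rewrite -powR_mulrn ?powR_ge0// -powRrM mulrC. Qed.

Unset Implicit Arguments.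

Theorem theorem3 (R : realType) (L sigma Delta c_beta c_eta : R) :
  0 < c_beta <= 1 -> 0 < c_eta ->
  exists C : R,
  forall (n d T : nat) (dO dX : measure_display)
    (Omega : measurableType dO) (P : probability Omega R)
    (Xi : measurableType dX) (D : 'I_n -> probability Xi R)
    (f : 'I_n -> 'rV[R]_d -> R) (gf : 'I_n -> 'rV[R]_d -> 'rV[R]_d)
    (G : 'I_n -> 'rV[R]_d -> Xi -> 'rV[R]_d)
    (xi : nat -> 'I_n -> Omega -> Xi)
    (x1 : 'rV[R]_d) (beta1 beta2 eta lambda : R),
  let F := fun x => n%:R^-1 * \sum_(j < n) f j x in
  let gF := fun x => n%:R^-1 *: \sum_(j < n) gf j x in
  (0 < n)%N -> (0 < d)%N -> (n <= T)%N ->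
  (* (D1) each f_j is L-smooth, with gradient gf j *)
  (forall j, has_gradient (f j) (gf j)) ->
  (forall j x y, enorm (gf j x - gf j y) <= L * enorm (x - y)) ->
  (* (D3) unbiased stochastic gradients with variance at most sigma^2
     (plus joint measurability of the oracle) *)
  (forall j (i : 'I_d), measurable_fun setT
      (fun p : d.-tuple R * Xi => G j (rv_of_tuple p.1) p.2 0 i)) ->
  (forall j x (i : 'I_d), (D j).-integrable setT (fun s => (G j x s 0 i)%:E)) ->
  (forall j x (i : 'I_d), (\int[D j]_s (G j x s 0 i)%:E)%E = (gf j x 0 i)%:E) ->
  (forall j x, (\int[D j]_s ((enorm (G j x s - gf j x)) ^+ 2)%:E
                 <= (sigma ^+ 2)%:E)%E) ->
  (* (D4): f bounded below and f(x_1) - f_* <= Delta *)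
  (forall x, F x1 - F x <= Delta) ->
  (* sampling: fresh independent samples xi_t^j ~ D_j *)
  indep_samples T P D xi ->
  (* step sizes *)
  beta2 = c_beta * Num.sqrt (n%:R / T%:R) ->
  beta2 ^+ 2 <= beta1 <= Num.sqrt beta2 ->
  eta = c_eta * (n%:R `^ (4%:R^-1)) / (Num.sqrt d%:R * T%:R `^ (3%:R / 4%:R)) ->
  0 <= lambda <= (2 * eta * T%:R)^-1 ->
  normInf x1 <= eta ->
  ((T%:R^-1)%:E * \sum_(1 <= t < T.+1)
      \int[P]_w (norm1 (gF (lion_x G (fun t j => xi t j w)
                                     x1 beta1 beta2 eta lambda t)))%:E
   <= (C * Num.sqrt d%:R / (n%:R `^ (4%:R^-1) * T%:R `^ (4%:R^-1)))%:E)%E.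
Proof.
move=> /andP[cb0 cb1] ce0; exists (2 * Delta / c_eta +
  9 / 4 * (L ^+ 2 + 1) * c_eta + 2 + 6 * (2 * sigma ^+ 2 / c_beta +
  9 / 4 * L ^+ 2 * c_eta ^+ 2 / c_beta ^+ 2 + 9 / 4 * L ^+ 2 * c_eta ^+ 2 +
  2 * c_beta * sigma ^+ 2)).
move=> n d T dO dX Omega P Xi D f gf G xi x1 beta1 beta2 eta lambda F gF.
move=> n0 d0 nT gradf lip mG iG eG vG FD xiP beta2E /andP[b1l b1u] etaE.
move=> /andP[l0 lT] x1eta.
have T0 : (0 < T)%N := leq_trans n0 nT.
set p := n%:R `^ (4%:R^-1); set q := T%:R `^ (4%:R^-1).
set s := Num.sqrt d%:R.
have nE : n%:R = p ^+ 4 by rewrite -powR_quarter// divff// powRr1.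
have TE : T%:R = q ^+ 4 by rewrite -powR_quarter// divff// powRr1.
have dE : d%:R = s ^+ 2 by rewrite sqr_sqrtr.
have p1 : 1 <= p by rewrite -(powRr0 n%:R) ler_powR ?ler1n ?invr_ge0.
have pq : p <= q by rewrite ge0_ler_powR ?nnegrE ?ler_nat ?invr_ge0.
have s0 : 0 < s by rewrite sqrtr_gt0 ltr0n.
have p0 : 0 < p by lra.
have q0 : 0 < q by lra.
have Delta0 : 0 <= Delta by rewrite -(subrr (F x1)).
have beta2E' : beta2 = c_beta * (p ^+ 2 / q ^+ 2).
  rewrite beta2E nE TE; congr (_ * _).
  rewrite (_ : p ^+ 4 / q ^+ 4 = (p ^+ 2 / q ^+ 2) ^+ 2); last first.
    by field; rewrite gt_eqF.
  by rewrite sqrtr_sqr ger0_norm// divr_ge0 ?sqr_ge0.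
have etaE' : eta = c_eta * p / (s * q ^+ 3).
  by rewrite etaE powR_quarter.
have eta0 : 0 < eta by rewrite etaE' divr_gt0 ?mulr_gt0 ?exprn_gt0.
have r1 : p ^+ 2 / q ^+ 2 <= 1.
  by rewrite ler_pdivrMr ?exprn_gt0// mul1r lerXn2r// nnegrE ltW.
have b20 : 0 < beta2 by rewrite beta2E' mulr_gt0 ?divr_gt0 ?exprn_gt0.
have b21 : beta2 <= 1.
  rewrite beta2E'; apply: le_trans cb1; rewrite ler_piMr// ltW//.
have b10 : 0 <= beta1 by apply: le_trans b1l; exact: sqr_ge0.
have b12 : beta1 ^+ 2 <= beta2.
  by rewrite -[leRHS]sqr_sqrtr ?(ltW b20)// lerXn2r ?nnegrE ?sqrtr_ge0.
have b11 : beta1 <= 1.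
  by apply: le_trans b1u _; rewrite -sqrtr1 ler_wsqrtr.
have oG j : unbiased_oracle (D j) sigma (gf j) (G j) by split=> *; auto.
(* The averaged squared update error is of order [(p q)^-2], so the two terms of Young's inequality
   balance at [rho = (p q)^-1]. *)
have rho0 : 0 < (p * q)^-1 by rewrite invr_gt0 mulr_gt0.
have E := @sum_gradient_bound R d n T dO dX Omega P Xi D f gf G xi x1 beta1 beta2
  eta lambda L sigma Delta n0 d0 gradf lip oG FD xiP _ _ b12 eta0 l0 lT x1eta
  (p * q)^-1 T0 rho0.
have {E} := E (introT andP (conj b20 b21)) (introT andP (conj b10 b11)).
(* Times 1 to [T] become indices below [T], since [lion_x] at time [k + 1] reads state [k]. *)
rewrite big_add1 big_mkord => E.
apply: (le_trans (lee_wpmul2l _ E)); first by rewrite lee_fin invr_ge0.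
rewrite -EFinM lee_fin -/s.
have := rate_bound L sigma (introT andP (conj p1 pq)) s0 cb0 ce0 Delta0.
by rewrite /= -beta2E' -etaE' -nE -TE -dE.
Qed.
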